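(* Let $N$ and $a$ be two positive integers. The following quantities all have the same maximal value $\binom{N}{a}$: \begin{enumerate} \item the number of $1$-stars with $a$ arms contained in a directed graph with $N$ edges; \item the sum $$\sum_{1\text{-stars with }a\text{ arms contained in }\Gamma}\mathrm{ct}(\text{star}),$$ for $\mathbb{Z}_{\ge 0}$-labeled directed graphs $\Gamma$ of weight $N$; \item the $a$-th elementary symmetric sum evaluated at some $t$-tuple of non-negative integers with sum $N$ (for varying $t$): $$\sum_{1\le i_1<\cdots<i_a\le t}\lambda_{i_1}\cdots\lambda_{i_a},\qquad \lambda_i\in\mathbb{Z}_{\ge 0},\quad \sum_{i=1}^t\lambda_i=N.$$ \end{enumerate}
   Context: All graphs are finite and directed. A $1$-star with $a$ arms is a directed graph consisting of a root vertex $v$, $a$ further distinct vertices $w_1,\dots,w_a$ (all different from $v$), and exactly the $a$ edges $w_i\to v$, $1\le i\le a$. The $1$-stars with $a$ arms contained in a graph are its (not necessarily induced) subgraphs isomorphic to this graph. In item (1) directed graphs may have repeated edges, and subgraphs using different parallel edges are counted as different. A $\mathbb{Z}_{\ge 0}$-labeled directed graph is a directed graph without repeated edges in which every ordered pair $(x,y)$ of vertices carries a label $\ell(x,y)\in\mathbb{Z}_{\ge 0}$, with $\ell(x,y)=0$ precisely when $(x,y)$ is not an edge. Its weight is the sum of the labels of its edges. The content $\mathrm{ct}$ of a labeled graph is the product of the labels of its edges; the content of a star contained in $\Gamma$ is computed with the labels inherited from $\Gamma$. *)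

(* Defs.v *)
From mathcomp Require Import all_boot.

Set Implicit Arguments.
Unset Strict Implicit.
Unset Printing Implicit Defensive.

(* Edges form a type of their own, so parallel edges (and loops) are allowed. *)
Record digraph := Digraph {
  vertex : finType;
  edge : finType;
  source : edge -> vertex;
  target : edge -> vertex
}.

(* A pair (W, S) of a vertex set and an edge set, closed under endpoints. *)
Definition is_subgraph (G : digraph) (H : {set vertex G} * {set edge G}) :=
  [forall e in H.2, (source e \in H.1) && (target e \in H.1)].

(* An isomorphism from K onto the subgraph H of G is given by injections on
   vertices and on edges, with images H.1 and H.2, preserving endpoints. *)
Definition isomorphic_to (K G : digraph)
    (H : {set vertex G} * {set edge G}) :=
  [exists f : {ffun vertex K -> vertex G},
   exists g : {ffun edge K -> edge G},
   [&& injectiveb f, injectiveb g,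
       H.1 == [set f x | x : vertex K], H.2 == [set g e | e : edge K] &
       [forall e, (source (g e) == f (source e)) &&
                  (target (g e) == f (target e))]]].

(* The root is None, and the i-th edge goes from Some i to the root. *)
Definition one_star (a : nat) : digraph :=
  @Digraph (option 'I_a) 'I_a (fun i => Some i) (fun=> None).

Definition stars (a : nat) (G : digraph) :
    {set {set vertex G} * {set edge G}} :=
  [set H | is_subgraph H && isomorphic_to (one_star a) H].

Record labeled_digraph := LabeledDigraph {
  lvertex : finType;
  ledge : rel lvertex;
  label : lvertex -> lvertex -> nat;
  label_eq0 : forall x y, (label x y == 0) = ~~ ledge x y
}.

Definition underlying (L : labeled_digraph) : digraph :=
  @Digraph (lvertex L) {p : lvertex L * lvertex L | ledge p.1 p.2}
    (fun e => (val e).1) (fun e => (val e).2).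

Definition edge_label (L : labeled_digraph) (e : edge (underlying L)) : nat :=
  label (source e) (target e).

Definition weight (L : labeled_digraph) : nat :=
  \sum_(e : edge (underlying L)) edge_label e.

Definition content (L : labeled_digraph)
    (H : {set vertex (underlying L)} * {set edge (underlying L)}) : nat :=
  \prod_(e in H.2) edge_label e.

Definition elementary_sum (a t : nat) (lambda : 'I_t -> nat) : nat :=
  \sum_(i : a.-tuple 'I_t | sorted ltn (map val i)) \prod_(j <- i) lambda j.

Definition is_maximum (S : nat -> Prop) (m : nat) : Prop :=
  S m /\ forall k, S k -> k <= m.

(* Main.v *)
Require Import Defs.
From mathcomp Require Import all_boot.

Set Implicit Arguments.
Unset Strict Implicit.
Unset Printing Implicit Defensive.

(** The three maxima agree because each quantity is bounded by an elementary
    symmetric sum, over the [a]-element subsets of a finite set.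

    A star with at least one arm is recovered from its set of edges, since
    every vertex of it is an endpoint of an edge ([star_vertices]).  The stars
    with [a] arms in [G] thus embed in the [a]-element sets of edges, and a
    sum over them of products of edge weights is at most the elementary
    symmetric sum [e_a] of all the edge weights.  Item (1) is the case of
    weights 1, item (2) that of the labels, and item (3) is an elementary
    symmetric sum from the start.

    The common bound is [e_a(lambda) <= 'C(\sum_i lambda_i, a)]
    ([leq_elementary_bin]).  Replacing each index [i] by [lambda_i] copies of
    it, the left side counts the [a]-element sets of copies that use each index
    at most once, and the right side counts all of them; the proof adds the
    indices one at a time, which reduces it to the two-block inequality
    [leq_bin_block].

    The bound is attained with [N] weights equal to 1, since [e_a] then counts
    the [a]-element subsets.  For the graphs one also needs every set of [a]
    edges to be a star, as in a star with [N] arms ([card_stars_in_star]). *)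

(** * Elementary symmetric sums *)

(** Of the ways to choose [k.+1] among [m + n] elements, the left side keeps
    those that use at most one of the first [m]. *)
Lemma leq_bin_block m n k : 'C(n, k.+1) + m * 'C(n, k) <= 'C(m + n, k.+1).
Proof.
elim: m => [|m IHm]; first by rewrite mul0n addn0.
rewrite mulSn addnCA addnC addSn binS leq_add //.
by rewrite leq_bin2l // leq_addl.
Qed.

Section ElementarySums.

Variables (I : finType) (lambda : I -> nat).

(** Restricting the indices to [A] is what makes induction on [A] possible. *)
Definition elementary_on (a : nat) (A : {set I}) :=
  \sum_(S : {set I} | (S \subset A) && (#|S| == a)) \prod_(i in S) lambda i.

Lemma elementary_on0 A : elementary_on 0 A = 1.
Proof.
rewrite /elementary_on (big_pred1 set0) ?big_set0 // => S.
by rewrite /= cards_eq0 andb_idl // => /eqP ->; rewrite sub0set.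
Qed.

(** The subsets of [x |: A] split according to whether they contain [x]. *)
Lemma elementary_onU1 a x (A : {set I}) : x \notin A ->
  elementary_on a.+1 (x |: A) =
    elementary_on a.+1 A + lambda x * elementary_on a A.
Proof.
move=> xNA; rewrite /elementary_on (bigID (fun S : {set I} => x \in S)) /=.
rewrite addnC; congr (_ + _).
  apply: eq_bigl => S; rewrite andbAC; congr (_ && _).
  by rewrite -subsetD1 setU1K.
have notin (S : {set I}) : S \subset A -> x \notin S.
  by move=> SA; apply: contra xNA => /(subsetP SA).
rewrite big_distrr /= (reindex_onto (fun S => x |: S) (fun S => S :\ x)) /=;
  last by move=> S /andP[_ xS]; rewrite setD1K.
apply: eq_big => [S|S /andP[/andP[/andP[_ _] _] /eqP <-]]; last first.
  by rewrite big_setU1 // !inE eqxx.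
have [xS|xNS] := boolP (x \in S).
  rewrite (_ : _ == S = false) ?andbF; last first.
    by apply/eqP => /setP/(_ x); rewrite xS !inE eqxx.
  by apply/esym/negbTE/negP => /andP[/notin]; rewrite xS.
rewrite setU1K // eqxx setU11 !andbT cardsU1 xNS add1n eqSS.
by rewrite subUset sub1set setU11 -[in RHS](setU1K xNA) subsetD1 xNS andbT.
Qed.

Lemma leq_elementary_on_bin a A :
  elementary_on a A <= 'C(\sum_(i in A) lambda i, a).
Proof.
elim: {A}_.+1 {-2}A (ltnSn #|A|) a => // n IHn A ltAn [|a].
  by rewrite elementary_on0 bin0.
have [->|[x xA]] := set_0Vmem A.
  rewrite /elementary_on [X in X <= _]big_pred0 // => S; rewrite subset0.
  by apply/andP => -[/eqP ->]; rewrite cards0.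
rewrite (cardsD1 x) xA add1n ltnS in ltAn.
rewrite -(setD1K xA) elementary_onU1 ?big_setU1 ?setD11 //=.
apply: leq_trans (leq_bin_block _ _ _).
by rewrite leq_add ?leq_mul2l ?IHn ?orbT.
Qed.

Lemma leq_elementary_bin (a : nat) :
  \sum_(S : {set I} | #|S| == a) \prod_(i in S) lambda i
    <= 'C(\sum_i lambda i, a).
Proof.
rewrite (eq_bigl (fun S : {set I} => (S \subset setT) && (#|S| == a))); last first.
  by move=> S; rewrite subsetT.
rewrite (eq_bigl (mem [set: I])); first exact: leq_elementary_on_bin.
by move=> i; apply/esym; exact: in_setT.
Qed.

(** Both sorted tuples and stars are counted through the set of indices they
    use: objects that are told apart by these sets contribute at most an
    elementary symmetric sum. *)
Lemma leq_sum_support_bin (J : finType) (P : pred J) (h : J -> {set I}) a :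
    {in P &, injective h} -> (forall j, P j -> #|h j| = a) ->
  \sum_(j | P j) \prod_(i in h j) lambda i <= 'C(\sum_i lambda i, a).
Proof.
move=> h_inj card_h; apply: leq_trans (leq_elementary_bin a).
have <- : \sum_(S in h @: P) \prod_(i in S) lambda i =
          \sum_(j | P j) \prod_(i in h j) lambda i by rewrite big_imset.
rewrite [X in _ <= X](bigID (mem (h @: P))) /=; apply: leq_trans (leq_addr _ _).
rewrite leq_eqVlt; apply/orP; left; apply/eqP/eq_bigl => S.
by apply/idP/andP => [/imsetP[j Pj ->]|[]//]; rewrite card_h ?imset_f.
Qed.

End ElementarySums.

Lemma elementary_sum_leq_bin a t (lambda : 'I_t -> nat) :
  elementary_sum a lambda <= 'C(\sum_(i < t) lambda i, a).
Proof.
pose h (u : a.-tuple 'I_t) := [set i in u].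
have uniq_sorted (u : a.-tuple 'I_t) : sorted ltn (map val u) -> uniq u.
  by move/(sorted_uniq ltn_trans ltnn); rewrite (map_inj_uniq val_inj).
rewrite /elementary_sum.
rewrite (eq_bigr (fun u => \prod_(i in h u) lambda i)); last first.
  move=> u /uniq_sorted uniq_u; rewrite big_uniq //.
  by apply: eq_bigl => i; rewrite inE.
apply: leq_sum_support_bin => [u w su sw /setP eq_uw|u /uniq_sorted uniq_u].
  apply: val_inj; apply: (inj_map val_inj).
  apply: (irr_sorted_eq ltn_trans ltnn) => // y.
  by apply/mapP/mapP => -[x xu ->]; exists x => //; have := eq_uw x;
    rewrite !inE xu.
by rewrite cardsE (card_uniqP uniq_u) size_tuple.
Qed.

Lemma elementary_sum_cst1 a t : elementary_sum a (fun _ : 'I_t => 1) = 'C(t, a).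
Proof.
rewrite /elementary_sum -card_ltn_sorted_tuples -sum1dep_card.
by apply: eq_bigr => u _; rewrite big1.
Qed.

(** * Stars and sets of edges *)

Section Stars.

Variable G : digraph.

Lemma card_star_edges a H : H \in stars a G -> #|H.2| = a.
Proof.
rewrite inE => /andP[_ /existsP[f /existsP[g /and5P[_ /injectiveP g_inj _]]]].
by move=> /eqP -> _; rewrite card_imset // card_ord.
Qed.

(** The root is an endpoint of an edge because there is at least one arm. *)
Lemma star_vertices a H : 0 < a -> H \in stars a G ->
  H.1 = [set source e | e in H.2] :|: [set target e | e in H.2].
Proof.
case: a => // a _; rewrite inE.
case/andP=> /forall_inP subH /existsP[f /existsP[g]].
case/and5P=> _ _ /eqP H1 /eqP H2 /forallP fg.
apply/eqP; rewrite eqEsubset; apply/andP; split; last first.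
  by apply/subsetP => x /setUP[] /imsetP[e /subH/andP[? ?] ->].
rewrite H1; apply/subsetP => _ /imsetP[[i|] _ ->]; apply/setUP; [left|right].
  have /andP[/eqP <- _] := fg i.
  by rewrite imset_f // H2 imset_f.
have /andP[_ /eqP <-] := fg ord0.
by rewrite imset_f // H2 imset_f.
Qed.

Lemma star_edges_inj a : 0 < a -> {in stars a G &, injective snd}.
Proof.
move=> a_gt0 H K sH sK eqHK; rewrite [H]surjective_pairing [K]surjective_pairing.
by rewrite (star_vertices a_gt0 sH) (star_vertices a_gt0 sK) eqHK.
Qed.

Lemma leq_sum_stars_bin a (w : edge G -> nat) : 0 < a ->
  \sum_(H in stars a G) \prod_(e in H.2) w e <= 'C(\sum_e w e, a).
Proof.
move=> a_gt0; apply: leq_sum_support_bin => [|H]; first exact: star_edges_inj.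
exact: card_star_edges.
Qed.

Lemma leq_card_stars_bin a : 0 < a -> #|stars a G| <= 'C(#|edge G|, a).
Proof.
move=> a_gt0; have := leq_sum_stars_bin (fun=> 1) a_gt0.
rewrite sum1_card; apply: leq_trans.
by rewrite (eq_bigr (fun=> 1)) ?sum1_card // => H _; rewrite big1.
Qed.

(** The remaining lemmas take place in a graph [G] that is itself a star with
    root [v], up to isolated vertices. *)
Variable v : vertex G.
Hypotheses (target_root : forall e : edge G, target e = v)
  (source_neq_root : forall e : edge G, source e != v)
  (source_inj : injective (@source G)).

Lemma edge_set_star (S : {set edge G}) :
  (v |: [set source e | e in S], S) \in stars #|S| G.
Proof.
rewrite inE; apply/andP; split.
  apply/forall_inP => e eS /=.
  by rewrite target_root setU11 setU1r ?imset_f.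
pose g : {ffun 'I_#|S| -> edge G} := [ffun i => enum_val i].
pose f : {ffun option 'I_#|S| -> vertex G} :=
  [ffun x => if x is Some i then source (g i) else v].
have fS i : f (Some i) = source (g i) by rewrite ffunE.
have fN : f None = v by rewrite ffunE.
have gS i : g i \in S by rewrite ffunE enum_valP.
have g_inj : injective g by move=> i j; rewrite !ffunE => /enum_val_inj.
have S_g e : e \in S -> exists i, e = g i.
  by move=> eS; exists (enum_rank_in eS e); rewrite ffunE enum_rankK_in.
apply/existsP; exists f; apply/existsP; exists g; apply/and5P; split => /=.
- apply/injectiveP => -[i|] [j|] //; rewrite ?fS ?fN.
  + by move/source_inj/g_inj ->.
  + by move/eqP; rewrite (negPf (source_neq_root _)).
  + by move/esym/eqP; rewrite (negPf (source_neq_root _)).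
- exact/injectiveP.
- apply/eqP/setP => x; apply/setU1P/imsetP => [[->|/imsetP[e /S_g[i ->] ->]]|].
  + by exists None.
  + by exists (Some i).
  + by case=> -[i|] _ ->; rewrite ?fS ?fN; [right; rewrite imset_f | left].
- apply/eqP/setP => e.
  by apply/idP/imsetP => [/S_g[i ->]|[i _ ->//]]; exists i.
- by apply/forallP => i; rewrite fS fN target_root !eqxx.
Qed.

Lemma card_stars_in_star a : 0 < a -> #|stars a G| = 'C(#|edge G|, a).
Proof.
move=> a_gt0; rewrite -card_draws -(card_in_imset (star_edges_inj a_gt0)).
apply: eq_card => S; rewrite inE; apply/imsetP/eqP => [[H sH ->]|<-].
  exact: card_star_edges sH.
by exists (v |: [set source e | e in S], S); first exact: edge_set_star.
Qed.

End Stars.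

(** * The labeled star with unit labels *)

Section UnitStar.

Variable N : nat.

Definition unit_star_edge : rel (option 'I_N) := fun x y => x && ~~ y.

Lemma unit_star_label_eq0 x y :
  ((unit_star_edge x y : nat) == 0) = ~~ unit_star_edge x y.
Proof. by rewrite eqb0. Qed.

Definition unit_star := LabeledDigraph unit_star_label_eq0.

Lemma unit_star_edge_label (e : edge (underlying unit_star)) : edge_label e = 1.
Proof. exact: (congr1 nat_of_bool (valP e)). Qed.

Lemma card_unit_star_edge : #|edge (underlying unit_star)| = N.
Proof.
pose h i : edge (underlying unit_star) :=
  @Sub _ (fun p => unit_star_edge p.1 p.2) _ (Some i, None) isT.
rewrite -[RHS]card_ord -(@card_imset _ _ h) => [|i j /(congr1 val)[]//].
apply/esym/eq_card => -[[[i|] [j|]] //= ij]; apply/imsetP; exists i => //.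
exact: val_inj.
Qed.

End UnitStar.

Theorem corollary2p10 (N a : nat) (hN : 0 < N) (ha : 0 < a) :
  [/\ is_maximum
        (fun k => exists2 G : digraph, #|edge G| = N & k = #|stars a G|)
        'C(N, a),
      is_maximum
        (fun k => exists2 L : labeled_digraph, weight L = N &
           k = \sum_(H in stars a (underlying L)) content H)
        'C(N, a)
    & is_maximum
        (fun k => exists (t : nat) (lambda : 'I_t -> nat),
           \sum_(i < t) lambda i = N /\ k = elementary_sum a lambda)
        'C(N, a)].

Proof.
split; split.
- exists (one_star N); first exact: card_ord.
  rewrite (@card_stars_in_star (one_star N) None) ?card_ord // => i j; exact: Some_inj.
- by move=> _ [G <- ->]; apply: leq_card_stars_bin.
- exists (unit_star N).
    rewrite /weight -[RHS]card_unit_star_edge -sum1_card.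
    by apply: eq_bigr => e _; apply: unit_star_edge_label.
  rewrite (eq_bigr (fun=> 1)) => [|H _]; last first.
    by rewrite /content big1 // => e _; apply: unit_star_edge_label.
  rewrite sum1_card (@card_stars_in_star (underlying (unit_star N)) None)
    ?card_unit_star_edge //.
  + by case=> -[x [y|]] /= /andP[].
  + by case=> -[[x|] y].
  + move=> [[x [?|]] /= ex] [[y [?|]] /= ey] exy;
      try by [case/andP: (ex) | case/andP: (ey)].
    by apply: val_inj; rewrite /= exy.
- by move=> _ [L <- ->]; apply: leq_sum_stars_bin.
- exists N, (fun=> 1); split; last by rewrite elementary_sum_cst1.
  by rewrite sum1_card card_ord.
- by move=> _ [t [lambda [<- ->]]]; apply: elementary_sum_leq_bin.
Qed.
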